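(* Let $G$ be a finite graph and $\mathcal L$ a non-trivial linear class of bonds of $G$. Then the independent sets of the join matroid $J(G,\mathcal L)$ are exactly the edge sets of forests $F$ of $G$ such that the partition $\pi_F$ is un-cobalanced.
   Context: Graphs are finite, loops and multiple edges allowed. A bond is a minimal nonempty edge cut; $\delta(X)$ is the set of links with exactly one endpoint in $X\subseteq V(G)$. A tribond is $\delta(X_1)\cup\delta(X_2)\cup\delta(X_3)$ for a partition $\{X_1,X_2,X_3\}$ of the vertex set of one connected component into nonempty sets with each $G[X_i]$ connected and an edge joining each pair. A linear class of bonds is a set $\mathcal L$ of bonds such that for each such tripartition the number of $i$ with $\delta(X_i)\in\mathcal L$ is never exactly two; it is trivial if it contains every bond; bonds in $\mathcal L$ are cobalanced. A modular pair of bonds $B_1,B_2$ is one for which $G-(B_1\cup B_2)$ has two more components than $G$; a dibond is the union of a modular pair that is not a tribond. For non-trivial $\mathcal L$, $J_0(G,\mathcal L)$ is the matroid on $E(G)\cup\{e_0\}$ whose cocircuits are the bonds in $\mathcal L$, the sets $B\cup\{e_0\}$ for bonds $B\notin\mathcal L$, and the tribonds and dibonds containing no bond of $\mathcal L$; $J(G,\mathcal L)=J_0(G,\mathcal L)/e_0$. For $F\subseteq E(G)$, $\pi_F$ is the partition of $V(G)$ into vertex sets of the components of $(V(G),F)$; $\mathrm{Ext}(\pi)$ is the set of edges of $G$ whose endpoints lie in different parts of $\pi$. A partition $\pi$ (with each part inducing a connected subgraph) is cobalanced if every bond of $G$ contained in $\mathrm{Ext}(\pi)$ lies in $\mathcal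 L$, and un-cobalanced otherwise. *)

(* Defs.v *)
From HB Require Import structures.
From mathcomp Require Import all_boot.

Set Implicit Arguments.
Unset Strict Implicit.
Unset Printing Implicit Defensive.

(** * Matroids on a finite ground set *)

Definition matroid_axiom (T : finType) (I : {set {set T}}) : bool :=
  [&& set0 \in I,
      [forall A in I, [forall B : {set T}, (B \subset A) ==> (B \in I)]]
    & [forall A in I, [forall B in I, (#|A| < #|B|) ==>
        [exists x in B :\: A, x |: A \in I]]]].

(* The axioms (I1)-(I3) are kept boolean so that matroids form a finite type. *)
Record matroid (T : finType) := Matroid {
  indep : {set {set T}};
  matroidP : matroid_axiom indep
}.

HB.instance Definition _ (T : finType) := [isSub for @indep T].
HB.instance Definition _ (T : finType) := [Finite of matroid T by <:].

Section MatroidNotions.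

Variable T : finType.
Implicit Types (M N : matroid T) (A B D : {set T}).

Definition base M B : bool := maxset [pred A : {set T} | A \in indep M] B.

(* Independence in the dual matroid, whose bases are the complements of the
   bases of M; a cocircuit is a circuit of the dual. *)
Definition coindep M A : bool := [exists B, base M B && (A \subset ~: B)].

Definition cocircuit M D : bool := minset [pred A | ~~ coindep M A] D.

Definition cocircuits M : {set {set T}} := [set D | cocircuit M D].

Lemma indep_sub M A B : A \in indep M -> B \subset A -> B \in indep M.
Proof.
case/and3P: (matroidP M) => _ /forall_inP h _ /h /forallP hA.
exact: (implyP (hA B)).
Qed.

Lemma indep_aug M A B : A \in indep M -> B \in indep M -> #|A| < #|B| ->
  exists2 x, x \in B :\: A & x |: A \in indep M.
Proof.
case/and3P: (matroidP M) => _ _ /forall_inP h /h /forall_inP hA /hA /implyP hB.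
by move=> /hB /exists_inP.
Qed.

Lemma coindepPn M A :
  reflect (exists2 D, D \in cocircuits M & D \subset A) (~~ coindep M A).
Proof.
apply: (iffP idP) => [nA | [D]].
  case: (@minset_exists _ [pred A | ~~ coindep M A] A nA) => D minD sDA.
  by exists D => //; rewrite inE.
rewrite inE => /minsetp /= nD sDA; apply: contra nD => /existsP[B].
case/andP=> bB sAB; apply/existsP; exists B; rewrite bB.
exact: subset_trans sAB.
Qed.

Lemma cocircuits_inj : injective cocircuits.
Proof.
have sub M N : cocircuits M = cocircuits N -> indep M \subset indep N.
  move=> eqMN; have eqco A : coindep M A = coindep N A.
    apply: negb_inj; apply/coindepPn/coindepPn => -[D hD sDA]; exists D => //.
      by rewrite -eqMN.
    by rewrite eqMN.
  apply/subsetP => A indA.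
  case: (@maxset_exists _ [pred A : {set T} | A \in indep M] A indA).
  move=> B maxB sAB.
  have: coindep N (~: B) by rewrite -eqco; apply/existsP; exists B; apply/andP.
  case/existsP=> B' /andP[bB']; rewrite setCS => sB'B.
  have: coindep M (~: B') by rewrite eqco; apply/existsP; exists B'; apply/andP.
  case/existsP=> B'' /andP[bB'']; rewrite setCS => sB''B'.
  have eqB : B = B''.
    case/maxsetP: bB'' => _ /(_ B) -> //; first exact: maxsetp maxB.
    exact: subset_trans sB'B.
  move: sB''B'; rewrite -eqB => sBB'.
  exact: (indep_sub (maxsetp bB')) (subset_trans sAB sBB').
move=> M N eqMN; apply: val_inj; apply/eqP; rewrite eqEsubset.
by rewrite !sub.
Qed.

Lemma loop_matroid_subproof : matroid_axiom [set set0 : {set T}].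
Proof.
apply/and3P; split; first by rewrite set11.
  apply/forall_inP => A /set1P ->; apply/forallP => B; apply/implyP.
  by rewrite subset0 inE.
apply/forall_inP => A /set1P ->; apply/forall_inP => B /set1P ->.
by rewrite ltnn.
Qed.

Definition loop_matroid : matroid T := Matroid loop_matroid_subproof.

(* By [cocircuits_inj] at most one matroid has a given set of cocircuits;
   [loop_matroid] is only a default value when there is none. *)
Definition matroid_of_cocircuits (C : {set {set T}}) : matroid T :=
  odflt loop_matroid [pick M : matroid T | cocircuits M == C].

End MatroidNotions.

Section Contraction.

Variables (T : finType) (M : matroid (option T)).

(* A basis of the set {None}: empty when None is a loop of M. *)
Definition basis_None : {set option T} :=
  if [set None] \in indep M then [set None] else set0.

Lemma contract_None_subproof :
  matroid_axiom [set A : {set T} | basis_None :|: Some @: A \in indep M].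
Proof.
have i0 : set0 \in indep M by case/and3P: (matroidP M).
have cardE (A : {set T}) : #|basis_None :|: Some @: A| = #|basis_None| + #|A|.
  have <- : #|Some @: A| = #|A| by apply: card_imset => ? ? [].
  have dis : basis_None :&: Some @: A = set0.
    apply/eqP; rewrite -subset0; apply/subsetP => x /setIP[xb /imsetP[y _ xE]].
    by move: xb; rewrite xE /basis_None; case: ifP => _; rewrite ?in_set1 ?in_set0.
  by rewrite cardsU dis cards0 subn0.
apply/and3P; split.
- by rewrite inE imset0 setU0 /basis_None; case: ifP.
- apply/forall_inP => A; rewrite inE => iA; apply/forallP => B; apply/implyP => sBA.
  by rewrite inE (indep_sub iA) // setUS // imsetS.
apply/forall_inP => A; rewrite inE => iA; apply/forall_inP => B; rewrite inE => iB.
apply/implyP => ltAB; have := indep_aug iA iB; rewrite !cardE ltn_add2l.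
case=> // x; rewrite in_setD !in_setU negb_or => /andP[/andP[xn xA]].
rewrite (negPf xn) /= => /imsetP[y yB xE] ix; apply/exists_inP; exists y.
  rewrite in_setD yB andbT; apply: contra xA => yA; rewrite xE; exact: imset_f.
by rewrite inE imsetU1 setUCA -xE.
Qed.

(* The contraction M / None: A is independent in M / {e} iff A together with a
   basis of {e} is independent in M. *)
Definition contract_None : matroid T := Matroid contract_None_subproof.

End Contraction.

(** * Finite multigraphs: loops and parallel edges allowed *)

(* The order of the two ends of an edge is irrelevant: see [joins]. *)
Record graph := Graph {
  vertex : finType;
  edge : finType;
  ends : edge -> vertex * vertex
}.

Section GraphNotions.

Variable G : graph.
Implicit Types (e : edge G) (F D B : {set edge G}) (X Y C : {set vertex G}).
Implicit Types (P : {set {set vertex G}}) (L : {set {set edge G}}).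

Definition joins e (x y : vertex G) : bool :=
  (ends e == (x, y)) || (ends e == (y, x)).

Definition adj F : rel (vertex G) := [rel x y | [exists e in F, joins e x y]].

(* The vertex sets of the components of the spanning subgraph (V(G), F), that
   is, the partition pi_F. *)
Definition components F : {set {set vertex G}} :=
  equivalence_partition (connect (adj F)) [set: vertex G].

Definition induced_edges X : {set edge G} :=
  [set e | ((ends e).1 \in X) && ((ends e).2 \in X)].

Definition induces_connected X : bool :=
  [forall x in X, forall y in X, connect (adj (induced_edges X)) x y].

Definition linked X Y : bool :=
  [exists x in X, exists y in Y, adj [set: edge G] x y].

Definition delta X : {set edge G} :=
  [set e | ((ends e).1 \in X) != ((ends e).2 \in X)].

Definition edge_cut D : bool := [exists X, D == delta X].

Definition bond B : bool := minset [pred D | (D != set0) && edge_cut D] B.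

Definition tripartition P : bool :=
  [&& [exists C in components [set: edge G], partition P C],
      #|P| == 3,
      [forall X in P, induces_connected X]
    & [forall X in P, forall Y in P, (X != Y) ==> linked X Y]].

Definition tribond D : bool :=
  [exists P, tripartition P && (D == \bigcup_(X in P) delta X)].

Definition modular_pair B1 B2 : bool :=
  [&& bond B1, bond B2 &
      #|components (~: (B1 :|: B2))| == #|components [set: edge G]| + 2].

Definition dibond D : bool :=
  [exists B1, exists B2, modular_pair B1 B2 && (D == B1 :|: B2)]
  && ~~ tribond D.

Definition linear_class L : Prop :=
  (forall B, B \in L -> bond B) /\
  (forall P, tripartition P -> #|[set X in P | delta X \in L]| <> 2).

Definition trivial_class L : Prop := forall B, bond B -> B \in L.

(* A cycle is given by a cyclic sequence of pairs (v_i, e_i), with distinct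
   vertices and distinct edges, where e_i joins v_i to v_(i+1). In particular
   a loop is a cycle of length 1 and two parallel links form one of length 2. *)
Definition graph_cycle (s : seq (vertex G * edge G)) : bool :=
  [&& s != [::], uniq (unzip1 s), uniq (unzip2 s)
    & cycle [rel p q | joins p.2 p.1 q.1] s].

Definition forest F : Prop :=
  ~ exists2 s, graph_cycle s & {subset unzip2 s <= F}.

Definition Ext P : {set edge G} :=
  [set e | pblock P (ends e).1 != pblock P (ends e).2].

Definition cobalanced L P : Prop :=
  forall B, bond B -> B \subset Ext P -> B \in L.

(** * The join matroid *)

(* The ground set E(G) + {e_0} is [option (edge G)], with e_0 = None. *)
Definition J0_cocircuits L : {set {set option (edge G)}} :=
  [set Some @: B | B : {set edge G} in L]
  :|: [set None |: Some @: B | B : {set edge G} & bond B && (B \notin L)]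
  :|: [set Some @: D | D : {set edge G} &
         (tribond D || dibond D) && [forall B in L, ~~ (B \subset D)]].

Definition J0 L : matroid (option (edge G)) :=
  matroid_of_cocircuits (J0_cocircuits L).

Definition join_matroid L : matroid (edge G) := contract_None (J0 L).

End GraphNotions.

(* Main.v *)
(* A set F of edges misses a bond B exactly when B lies in Ext (pi_F), so pi_F is
   un-cobalanced iff some bond outside L is disjoint from F.  Let N be the set
   system on E(G) + {e_0} made of the forests F and of the sets F + e_0 with F a
   forest such that pi_F is un-cobalanced.  N is a matroid; augmentation comes down
   to a modularity property: if A + x and A + y are cobalanced and y is not spanned
   by A + x, then A is cobalanced.  Indeed a bond D = delta(X) disjoint from A and
   containing x and y has a side, X say, in which A does not connect the ends of x
   and y; splitting X along A into two connected parts gives a tripartition with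
   delta of the two parts in L, hence D is in L.

   The codependent sets of N that contain e_0 are those containing a bond; the
   others are those that contain a bond of L or whose deletion creates at least two
   new components.  The minimal sets of the last kind are the unions of modular
   pairs, that is, the tribonds and dibonds.  Hence N has the prescribed cocircuits
   and equals J_0(G, L), and contracting e_0 gives the theorem. *)
Require Import Defs.
From HB Require Import structures.
From mathcomp Require Import all_boot.

Set Implicit Arguments.
Unset Strict Implicit.
Unset Printing Implicit Defensive.

(** * Components and edge cuts *)

Lemma disjoint_setU1 (T : finType) (x : T) (A B : {set T}) :
  [disjoint x |: A & B] = (x \notin B) && [disjoint A & B].
Proof. by rewrite !disjoints_subset subUset sub1set in_setC. Qed.

Lemma disjointP (T : finType) (A B : {set T}) :
  reflect {in A, forall x, x \notin B} [disjoint A & B].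
Proof. by rewrite disjoint_subset; apply: (iffP subsetP) => h x /h. Qed.

Lemma disjoint_setC (T : finType) (A : {set T}) : [disjoint A & ~: A].
Proof. by rewrite -setI_eq0 setICr. Qed.

Section Connectivity.

Variable G : graph.
Implicit Types (e f : edge G) (u v x y : vertex G).
Implicit Types (S R F B D : {set edge G}) (X Y C : {set vertex G}).

Definition con S : rel (vertex G) := connect (adj S).
Definition con_ends S e : bool := con S (ends e).1 (ends e).2.
Definition cls S x : {set vertex G} := [set y | con S x y].
Definition ncomp S : nat := #|components S|.

Lemma adj_sym S : symmetric (adj S).
Proof.
by move=> x y; apply/exists_inP/exists_inP => -[e eS]; rewrite /joins orbC;
  exists e.
Qed.

Lemma con_sym S : symmetric (con S).
Proof. exact/sym_connect_sym/adj_sym. Qed.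

Lemma con_same S : left_transitive (con S).
Proof. exact: same_connect (@con_sym S). Qed.

Lemma con_trans S : transitive (con S).
Proof. exact: connect_trans. Qed.

Lemma con_refl S : reflexive (con S).
Proof. by move=> x; apply: connect0. Qed.

Lemma con_edge S e : e \in S -> con_ends S e.
Proof.
move=> eS; apply: connect1; apply/exists_inP; exists e => //.
by rewrite /joins; case: (ends e) => ? ? /=; rewrite eqxx.
Qed.

Lemma sub_con S R :
  (forall e, e \in S -> con_ends R e) -> subrel (con S) (con R).
Proof.
move=> h; apply: connect_sub => x y /exists_inP[e /h].
rewrite /con_ends /joins; case: (ends e) => a b /= ab.
by case/orP=> /eqP[<- <-] //; rewrite -/(con R _ _) con_sym.
Qed.

Lemma con_mono S R : S \subset R -> subrel (con S) (con R).
Proof. by move=> sSR; apply: sub_con => e /(subsetP sSR); apply: con_edge. Qed.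

(** Membership in [X] is constant along every edge outside [delta X], hence along paths. This is the
    tool for refuting connectivity: exhibit a vertex set whose cut is avoided. *)
Lemma con_cut S X : [disjoint S & delta X] ->
  forall x y, con S x y -> (x \in X) = (y \in X).
Proof.
move=> dis; apply: closed_connect => x y /exists_inP[e eS].
have := disjointFr dis eS; rewrite inE /joins.
by case: (ends e) => a b /= /negbFE /eqP ab /orP[] /eqP[<- <-].
Qed.

Lemma in_delta X e : (e \in delta X) = (((ends e).1 \in X) != ((ends e).2 \in X)).
Proof. by rewrite inE. Qed.

Lemma mem_cls S x y : (y \in cls S x) = con S x y.
Proof. by rewrite inE. Qed.

Lemma cls_refl S x : x \in cls S x.
Proof. by rewrite mem_cls con_refl. Qed.

Lemma con_cls S x y : con S x y -> cls S x = cls S y.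
Proof.
move=> xy; apply/setP => z; rewrite !mem_cls.
exact: con_same.
Qed.

Lemma eq_cls S x y : (cls S x == cls S y) = con S x y.
Proof.
apply/eqP/idP => [E|/con_cls //]; by rewrite -mem_cls E cls_refl.
Qed.

Lemma con_ends_delta S X e : [disjoint S & delta X] -> con_ends S e ->
  e \notin delta X.
Proof. by move=> /con_cut h /h E; rewrite in_delta E eqxx. Qed.

Lemma cls_cut S x : [disjoint S & delta (cls S x)].
Proof.
apply/disjointP => e /con_edge h.
rewrite in_delta !mem_cls negbK; apply/eqP.
by rewrite ![con S x _]con_sym (con_same h).
Qed.

Lemma componentsE S : components S = [set cls S x | x in [set: vertex G]].
Proof.
by apply: eq_imset => x; apply/setP => y; rewrite !inE.
Qed.

Lemma componentsP S X : reflect (exists x, X = cls S x) (X \in components S).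
Proof.
rewrite componentsE; apply: (iffP imsetP) => [[x _ ->]|[x ->]]; by exists x.
Qed.

Lemma cls_component S x : cls S x \in components S.
Proof. by apply/componentsP; exists x. Qed.

Lemma component_cls S X x : X \in components S -> x \in X -> X = cls S x.
Proof. by case/componentsP => y ->; rewrite mem_cls => /con_cls. Qed.

Lemma eq_con_components S R : con S =2 con R -> components S = components R.
Proof.
move=> E; rewrite !componentsE; apply: eq_imset => x.
by apply/setP => y; rewrite !mem_cls E.
Qed.

Lemma con_eq S R : subrel (con S) (con R) -> subrel (con R) (con S) ->
  con S =2 con R.
Proof. by move=> SR RS x y; apply/idP/idP; [apply: SR | apply: RS]. Qed.

Lemma cls_setU1_out S e x : ~~ con S (ends e).1 x -> ~~ con S (ends e).2 x ->
  cls (e |: S) x = cls S x.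
Proof.
move=> n1 n2; apply/setP => y; rewrite !mem_cls.
apply/idP/idP => [h|]; last by apply: con_mono; apply: subsetUr.
suff dis : [disjoint e |: S & delta (cls S x)].
  by rewrite -mem_cls -(con_cut dis h) cls_refl.
rewrite disjoint_setU1 cls_cut andbT in_delta !mem_cls.
by rewrite ![con S x _]con_sym (negbTE n1) (negbTE n2).
Qed.

Lemma cls_setU1_in S e x : con S (ends e).1 x || con S (ends e).2 x ->
  cls (e |: S) x = cls S (ends e).1 :|: cls S (ends e).2.
Proof.
move=> h; have sub y z : con S y z -> con (e |: S) y z.
  by apply: con_mono; apply: subsetUr.
have ab : con_ends (e |: S) e by apply: con_edge; rewrite setU11.
have h1 : con (e |: S) (ends e).1 x.
  by case/orP: h => /sub // hb; apply: con_trans hb.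
rewrite -(con_cls h1); apply/setP => y; rewrite in_setU !mem_cls.
apply/idP/idP => [hy|/orP[/sub //|/sub hy]]; last exact: con_trans hy.
suff dis : [disjoint e |: S & delta (cls S (ends e).1 :|: cls S (ends e).2)].
  by have := con_cut dis hy; rewrite !in_setU !cls_refl !mem_cls.
rewrite disjoint_setU1 in_delta !in_setU !cls_refl orbT /=.
apply/disjointP => f fS; rewrite in_delta !in_setU.
by rewrite !(con_cut (cls_cut _ _) (con_edge fS)) eqxx.
Qed.

(** Adding [e] merges the classes of its two ends and leaves all others unchanged. *)
Lemma ncompU1 S e : ncomp S = ncomp (e |: S) + ~~ con_ends S e.
Proof.
rewrite /ncomp; case: (boolP (con_ends S e)) => h /=.
  rewrite addn0; congr #|pred_of_set _|; apply: eq_con_components; apply: con_eq.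
    by apply: con_mono; apply: subsetUr.
  by apply: sub_con => f /setU1P[->|/con_edge].
set a := (ends e).1; set b := (ends e).2.
have nab : cls S a != cls S b by rewrite eq_cls.
have -> : components (e |: S) =
    (cls S a :|: cls S b) |: (components S :\ cls S a :\ cls S b).
  apply/setP => X; apply/componentsP/setU1P => [[x ->]|[->|]].
  - case: (boolP (con S a x || con S b x)) => [/cls_setU1_in -> |]; first by left.
    rewrite negb_or => /andP[na nb]; right; rewrite cls_setU1_out // !in_setD1.
    by rewrite cls_component !eq_cls !(con_sym _ x) na nb.
  - by exists a; rewrite cls_setU1_in // con_refl.
  rewrite !in_setD1 => /and3P[nb na /componentsP[x E]]; exists x.
  move: na nb; rewrite E !eq_cls !(con_sym _ x) => na nb.
  by rewrite cls_setU1_out.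
rewrite cardsU1 (cardsD1 (cls S a)) cls_component (cardsD1 (cls S b)).
rewrite in_setD1 eq_sym nab cls_component.
suff -> : cls S a :|: cls S b \notin components S :\ cls S a :\ cls S b.
  by rewrite /= addn1.
rewrite !in_setD1; apply/negP => /and3P[_ na /component_cls].
move=> /(_ a); rewrite in_setU cls_refl => /(_ isT) E.
by move: na; rewrite E eqxx.
Qed.

(** Sending each [S]-class to the [R]-class that contains it is a surjection. *)
Lemma leq_ncomp S R : subrel (con S) (con R) -> ncomp R <= ncomp S.
Proof.
move=> SR; rewrite /ncomp.
have -> : components R = [set \bigcup_(x in X) cls R x | X : {set vertex G} in components S].
  apply/setP => Y; apply/componentsP/imsetP => [[y ->]|[X /componentsP[x ->] ->]].
    exists (cls S y); first exact: cls_component.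
    apply/setP => z; apply/idP/bigcupP => [yz|[w]]; first by exists y; rewrite ?cls_refl.
    by rewrite mem_cls => /SR /con_cls ->.
  exists x; apply/setP => z; apply/bigcupP/idP => [[w]|xz]; last by exists x; rewrite ?cls_refl.
  by rewrite mem_cls => /SR /con_cls ->.
exact: leq_imset_card.
Qed.

Lemma ncompS S R : S \subset R -> ncomp R <= ncomp S.
Proof. by move=> /con_mono /leq_ncomp. Qed.

(** If an edge of [R] joined two classes of [S], adding it to [S] would strictly lower the count
    while [R] still coarsens the result. *)
Lemma ncomp_eq_con S R : subrel (con S) (con R) -> ncomp S <= ncomp R ->
  subrel (con R) (con S).
Proof.
move=> SR le; apply: sub_con => e eR; apply: contraT => ne.
have := ncompU1 S e; rewrite ne /= => E.
suff : ncomp R <= ncomp (e |: S) by rewrite leqNgt -addn1 -E le.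
by apply: leq_ncomp; apply: sub_con => f /setU1P[->|/con_edge/SR //]; apply: con_edge.
Qed.

Lemma ncomp0 : ncomp set0 = #|vertex G|.
Proof.
rewrite /ncomp componentsE card_imset ?cardsT // => x y /eqP.
rewrite eq_cls => /connectP[[|z p]] /=; first by move=> _ ->.
by case/andP=> /exists_inP[e]; rewrite in_set0.
Qed.

End Connectivity.

(** * Forests *)

Section Forests.

Variable G : graph.
Implicit Types (e f : edge G) (u v x y : vertex G).
Implicit Types (S R F B D : {set edge G}) (X Y C : {set vertex G}).

(** A rank condition in place of the absence of cycles, suited to counting arguments; [forestP]
    proves the two equivalent. *)
Definition acyclic F : bool := #|F| + ncomp F == #|vertex G|.

Lemma card_ncompU1 F e : e \notin F ->
  #|e |: F| + ncomp (e |: F) = #|F| + ncomp F + con_ends F e.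
Proof.
move=> eF; rewrite cardsU1 eF (ncompU1 F e); case: con_ends => /=.
  by rewrite addn0 addn1 add1n addSn.
by rewrite addn0 add1n addn1 addSn addnS.
Qed.

Lemma card_ncomp_ge F : #|vertex G| <= #|F| + ncomp F.
Proof.
elim: {F}#|F| {-2}F (erefl #|F|) => [|n IH] F cF.
  by rewrite (cards0_eq cF) ncomp0 cards0.
have /card_gt0P[e eF] : 0 < #|F| by rewrite cF.
have eF' : e \notin F :\ e by rewrite setD11.
have := card_ncompU1 eF'; rewrite setD1K // => ->.
apply: leq_trans (leq_addr _ _); rewrite IH //.
by move: cF; rewrite (cardsD1 e) eF add1n => -[].
Qed.

Lemma acyclicU1 F e : e \notin F -> acyclic (e |: F) = acyclic F && ~~ con_ends F e.
Proof.
move=> eF; rewrite /acyclic card_ncompU1 //; case: con_ends => /=.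
  by rewrite andbF addn1 eqn_leq ltnNge card_ncomp_ge.
by rewrite andbT addn0.
Qed.

Lemma acyclicD1 F e : e \in F -> acyclic F = acyclic (F :\ e) && ~~ con_ends (F :\ e) e.
Proof. by move=> eF; rewrite -acyclicU1 ?setD1K // setD11. Qed.

Lemma acyclicS F D : D \subset F -> acyclic F -> acyclic D.
Proof.
elim: {F}#|F| {-2}F (erefl #|F|) => [|n IH] F cF sDF.
  by move: sDF; rewrite (cards0_eq cF) subset0 => /eqP ->.
case: (boolP (F \subset D)) => [sFD|]; first by have /eqP -> : D == F by rewrite eqEsubset sDF.
case/subsetPn=> e eF eD; rewrite (acyclicD1 eF) => /andP[aF _].
apply: (IH (F :\ e)) aF; last by rewrite subsetD1 sDF.
by move: cF; rewrite (cardsD1 e) eF add1n => -[].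
Qed.

Lemma acyclic0 : acyclic set0.
Proof. by rewrite /acyclic cards0 ncomp0. Qed.

Lemma acyclicU1_con F e : acyclic F -> ~~ con_ends F e -> acyclic (e |: F).
Proof.
move=> aF ne; rewrite acyclicU1 ?aF //.
by apply: contra ne => /con_edge.
Qed.

(** If [A] connected the ends of every edge of [B], it would have at most as many components as [B],
    against the counts for forests. *)
Lemma acyclic_aug A B : acyclic A -> acyclic B -> #|A| < #|B| ->
  exists2 x, x \in B & ~~ con_ends A x.
Proof.
move=> /eqP aA /eqP aB lt; apply/exists_inP; rewrite -negb_forall_in.
apply/negP => /forall_inP h.
have := leq_ncomp (sub_con h); rewrite leqNgt => /negP; apply.
by rewrite -(ltn_add2l #|A|) aA -aB ltn_add2r.
Qed.

Lemma spanning_forest S : exists T : {set edge G},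
  [/\ T \subset S, acyclic T & ncomp T = ncomp S].
Proof.
have h0 : (set0 \subset S) && acyclic set0 by rewrite sub0set acyclic0.
have [T /maxsetP[/andP[TS aT] max] _] :=
  maxset_exists (P := [pred T : {set edge G} | (T \subset S) && acyclic T]) h0.
exists T; split=> //; apply/eqP; rewrite eqn_leq (ncompS TS) andbT.
apply/leq_ncomp/sub_con => e eS; apply: contraT => ne.
have E : e |: T = T.
  by apply: max; rewrite ?subsetUr //= subUset sub1set eS TS acyclicU1_con.
by move: ne; rewrite con_edge // -E setU11.
Qed.

End Forests.

(** * Acyclic edge sets contain no graph cycle, and conversely *)

Section Cycles.

Variable G : graph.
Implicit Types (e f : edge G) (u v x y : vertex G) (F : {set edge G}).
Implicit Types (s : seq (vertex G * edge G)).

Local Notation step := [rel p q : vertex G * edge G | joins p.2 p.1 q.1].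

Lemma joins_con F e u v : e \in F -> joins e u v -> con F u v.
Proof. by move=> eF j; apply: connect1; apply/exists_inP; exists e. Qed.

Lemma joins_con_ends F e u v : joins e u v -> con F u v = con_ends F e.
Proof.
rewrite /joins /con_ends; case: (ends e) => a b /= /orP[] /eqP[<- <-] //.
exact: con_sym.
Qed.

Lemma joins_sym e u v : joins e u v = joins e v u.
Proof. by rewrite /joins orbC. Qed.

Lemma path_con F (p : vertex G * edge G) s :
  {subset unzip2 (p :: s) <= F} -> path step p s ->
  forall q, joins (last p s).2 (last p s).1 q -> con F p.1 q.
Proof.
elim: s p => [|p' s IH] p sub /=.
  by move=> _ q; apply: joins_con; apply: sub; rewrite mem_head.
case/andP=> pp' ps q jq.
have h : con F p.1 p'.1 by apply: joins_con pp'; apply: sub; rewrite mem_head.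
apply: con_trans h _; apply: IH ps _ jq => e es.
by apply: sub; rewrite inE es orbT.
Qed.

(** The first edge of a cycle has its ends connected by the remaining edges. *)
Lemma graph_cycle_not_acyclic s F :
  graph_cycle s -> {subset unzip2 s <= F} -> ~~ acyclic F.
Proof.
case: s => [|p s] //; case/and4P=> _ _ /= /andP[ps us].
rewrite rcons_path => /andP[path_s close] sub.
have eF : p.2 \in F by apply: sub; rewrite mem_head.
rewrite (acyclicD1 eF) negb_and negbK; apply/orP; right.
have sub' e : e \in unzip2 s -> e \in F :\ p.2.
  move=> es; rewrite in_setD1 sub ?inE ?es ?orbT // andbT.
  by apply: contraNneq ps => <-.
(* A cycle of length one is a loop, whose two ends coincide. *)
case: s {us ps sub} path_s close sub' => [_ /=|p' s /= /andP[pp' path_s] close sub'].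
  by move=> j _; rewrite -(joins_con_ends _ j) con_refl.
rewrite -(joins_con_ends _ pp') con_sym.
exact: (path_con (p := p') (s := s)).
Qed.

(* The edges chosen along a path with distinct vertices are distinct, because
   the edge leaving a vertex is not incident with the later vertices. *)
Lemma path_steps F u p : path (adj F) u p -> uniq (u :: p) ->
  exists es : seq (edge G), [/\ size es = size p, uniq es, {subset es <= F},
    forall f, f \in es -> exists w z, [/\ w \in u :: p, z \in u :: p & joins f w z] &
    forall v e, joins e (last u p) v ->
      path step (u, head e es) (zip p (rcons (behead es) e))
      /\ (last (u, head e es) (zip p (rcons (behead es) e))) = (last u p, e)].
Proof.
elim: p u => [|w p IH] u; first by exists [::].
rewrite [path _ _ _]/= => /andP[/exists_inP[f fF jf] pp] /[dup] uup.
rewrite cons_uniq => /andP[uwp /[dup] uwp' /(IH w pp)[es [sz ues sub inc steps]]].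
exists (f :: es); split=> [||e||v e j].
- by rewrite /= sz.
- rewrite /= ues andbT; apply/negP => /inc[a [b [aw bw jab]]].
  have : u \in [:: a; b].
    move: jf jab; rewrite /joins !inE => /orP[] /eqP -> /orP[] /eqP[E1 E2];
      by rewrite ?E1 ?E2 eqxx ?orbT.
  by rewrite !inE => /orP[] /eqP E; move: uwp; rewrite E ?aw ?bw.
- by rewrite inE => /predU1P[->|/sub].
- move=> g; rewrite inE => /predU1P[->|/inc[a [b [aw bw jab]]]].
    by exists u, w; rewrite !inE !eqxx ?orbT.
  by exists a, b; rewrite !(in_cons u) aw bw !orbT.
have [ps lst] := steps v e j.
have -> : zip (w :: p) (rcons (behead (f :: es)) e)
        = (w, head e es) :: zip p (rcons (behead es) e).
  by case: (es) sz => [|? ?] //=; case: (p).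
by rewrite /= jf ps lst.
Qed.

(** Induction on the number of edges: after removal of [e], either a cycle is still present, or the
    ends of [e] stay connected and a path with distinct vertices closes up with [e]. *)
Lemma not_acyclic_graph_cycle F : ~~ acyclic F ->
  exists2 s, graph_cycle s & {subset unzip2 s <= F}.
Proof.
elim: {F}#|F| {-2}F (erefl #|F|) => [|n IH] F cF.
  by rewrite (cards0_eq cF) acyclic0.
have /card_gt0P[e eF] : 0 < #|F| by rewrite cF.
have cFe : #|F :\ e| = n by move: cF; rewrite (cardsD1 e) eF add1n => -[].
rewrite (acyclicD1 eF) negb_and negbK => /orP[/IH[//|s cs sub]|].
  by exists s => // f /sub; rewrite in_setD1 => /andP[].
rewrite /con_ends /con => /connectP[p0 /shortenP[p pp up _] lp].
have je : joins e (last (ends e).1 p) (ends e).1.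
  by rewrite -lp /joins; case: (ends e) => a b; rewrite eqxx orbT.
have [es [sz ues sub _ steps]] := path_steps pp up.
have [ps lst] := steps _ _ je.
(* Each vertex of the path is paired with the edge leaving it, [e] leaving the last one. When the
   path is a single vertex, [e] is a loop and is supplied by the default of [head]. *)
set q := (_, _) in ps lst; set s := zip _ _ in ps lst.
have u2 : unzip2 (q :: s) = rcons es e.
  case: es sz @q @s ps lst {ues sub steps} => [|f es] sz q s _ _.
    by rewrite /s (size0nil (esym sz)).
  rewrite /= in sz; rewrite /s /=.
  by rewrite /unzip2 -/unzip2 unzip2_zip // size_rcons -sz.
have u1 : unzip1 (q :: s) = (ends e).1 :: p.
  rewrite /= -/(unzip1 s) unzip1_zip // size_rcons size_behead -sz.
  by case: (es) => //= *.
exists (q :: s); last first.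
  move=> f; rewrite u2 mem_rcons inE => /predU1P[-> //|/sub].
  by rewrite in_setD1 => /andP[].
apply/and4P; split=> //; first by rewrite u1.
  rewrite u2 rcons_uniq ues andbT; apply/negP => /sub.
  by rewrite setD11.
by rewrite /= rcons_path ps /= lst.
Qed.

Lemma forestP F : forest F <-> acyclic F.
Proof.
split=> [h|aF [s cs sub]]; last by have := graph_cycle_not_acyclic cs sub; rewrite aF.
by apply: contraT => /not_acyclic_graph_cycle.
Qed.

End Cycles.

(** * Bonds *)

Section Bonds.

Variable G : graph.
Implicit Types (e f : edge G) (u v x y : vertex G).
Implicit Types (S R F B D : {set edge G}) (X Y C : {set vertex G}).

Lemma bond_deltaP B : reflect
  [/\ B != set0, exists X, B = delta X &
      forall X, delta X \subset B -> delta X != set0 -> delta X = B] (bond B).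
Proof.
rewrite /bond; apply: (iffP minsetP) => [[/andP[B0 /existsP[X /eqP BX]] min]|[B0 [X BX] min]].
  split=> // [|Y sYB Y0]; first by exists X.
  by apply: min => //=; rewrite Y0; apply/existsP; exists Y.
split; first by rewrite /= B0 /=; apply/existsP; exists X; apply/eqP.
by move=> D /= /andP[D0 /existsP[Y /eqP DY]]; rewrite {}DY in D0 *; move/min; apply.
Qed.

Lemma bond_sub_eq B D : bond B -> bond D -> B \subset D -> B = D.
Proof. by case/bond_deltaP=> B0 [X E] _ /bond_deltaP[_ _ h] s; rewrite E; apply: h; rewrite -E. Qed.

Lemma exists_bond_delta X : delta X != set0 -> exists2 B, bond B & B \subset delta X.
Proof.
move=> X0; have h : [pred D | (D != set0) && edge_cut D] (delta X).
  by rewrite /= X0 /=; apply/existsP; exists X.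
by have [B bB sB] := minset_exists h; exists B.
Qed.

Lemma exists_bond S e : ~~ con_ends S e -> exists2 B, bond B & [disjoint B & S].
Proof.
move=> ne; have h : e \in delta (cls S (ends e).1).
  by rewrite in_delta cls_refl mem_cls -/(con_ends S e) (negPf ne).
have [|B bB sB] := @exists_bond_delta (cls S (ends e).1).
  by apply/set0Pn; exists e.
by exists B => //; rewrite (disjointWl sB) // disjoint_sym cls_cut.
Qed.

Lemma exists_bond_ncomp S : ncomp [set: edge G] < ncomp S ->
  exists2 B, bond B & [disjoint B & S].
Proof.
move=> lt; have /existsP[e] : [exists e, ~~ con_ends S e].
  apply: contraLR lt; rewrite -leqNgt => /existsPn h.
  by apply/leq_ncomp/sub_con => e _; have := h e; rewrite negbK.
exact: exists_bond.
Qed.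

Lemma bond_con_ends B S e : bond B -> [disjoint B & S] -> e \in B -> ~~ con_ends S e.
Proof.
move=> /bond_deltaP[_ [X ->] _]; rewrite disjoint_sym => dis eB.
by apply/negP => /(con_ends_delta dis); rewrite eB.
Qed.

Lemma bond_ncomp_gt B S : bond B -> [disjoint B & S] -> ncomp [set: edge G] < ncomp S.
Proof.
move=> bB dis; have /bond_deltaP[/set0Pn[e eB] _ _] := bB.
rewrite (ncompU1 S e) (bond_con_ends bB dis eB) addn1 ltnS.
exact/ncompS/subsetT.
Qed.

(** Bonds are incomparable, so some [e] lies in [B1] but not in [B2]. Adding [e] to [S] removes one
    component, and [B2] is still missed. *)
Lemma two_bonds_ncomp B1 B2 S : bond B1 -> bond B2 -> B1 != B2 ->
  [disjoint B1 & S] -> [disjoint B2 & S] -> ncomp [set: edge G] + 2 <= ncomp S.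
Proof.
move=> b1 b2 ne d1 d2; have /subsetPn[e e1 e2] : ~~ (B1 \subset B2).
  by apply: contra ne => /(bond_sub_eq b1 b2) ->.
rewrite (ncompU1 S e) (bond_con_ends b1 d1 e1) -[2]/(1 + 1) addnA leq_add2r addn1.
by apply: (bond_ncomp_gt b2); rewrite disjoint_sym disjoint_setU1 e2 disjoint_sym.
Qed.

(** Once one edge [e] of [B] is restored no further component is lost: another missed bond would lie
    in [B] without [e], against minimality. *)
Lemma bond_ncomp B : bond B -> ncomp (~: B) = ncomp [set: edge G] + 1.
Proof.
move=> bB; apply/eqP; rewrite eqn_leq {2}addn1 (bond_ncomp_gt bB (disjoint_setC B)).
have /bond_deltaP[/set0Pn[e eB] _ _] := bB.
rewrite (ncompU1 _ e) (bond_con_ends bB (disjoint_setC B) eB) leq_add2r andbT.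
rewrite leqNgt; apply/negP => /exists_bond_ncomp[B' bB' dis].
have s : B' \subset B.
  apply/subsetP => f fB'; have := disjointFr dis fB'.
  by rewrite !inE => /norP[_]; rewrite negbK.
have E := bond_sub_eq bB' bB s.
by have := disjointFl dis (setU11 _ _); rewrite E eB.
Qed.

(** Each of the two classes has a nonempty cut inside [B], hence equal to [B]. So every edge of [B]
    runs between them, and restoring [e] alone restores the whole component. *)
Lemma bond_sides B e (S := ~: B) : bond B -> e \in B ->
  [/\ B = delta (cls S (ends e).1), B = delta (cls S (ends e).2) &
      cls S (ends e).1 :|: cls S (ends e).2 = cls [set: edge G] (ends e).1].
Proof.
move=> bB eB; have ne : ~~ con_ends S e.
  exact: bond_con_ends (disjoint_setC B) eB.
have /bond_deltaP[_ _ min] := bB.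
have sub x : delta (cls S x) \subset B.
  by rewrite -[B]setCK -disjoints_subset disjoint_sym cls_cut.
have E1 : delta (cls S (ends e).1) = B.
  apply: min => //; apply/set0Pn; exists e.
  by rewrite in_delta cls_refl mem_cls -/(con_ends S e) (negPf ne).
have E2 : delta (cls S (ends e).2) = B.
  apply: min => //; apply/set0Pn; exists e.
  by rewrite in_delta cls_refl mem_cls con_sym -/(con_ends S e) (negPf ne).
split=> //; rewrite -(cls_setU1_in (x := (ends e).1)) ?con_refl //; apply/setP => x; rewrite !mem_cls.
apply/idP/idP; first exact/con_mono/subsetT.
apply: sub_con => f _; case: (boolP (f \in B)) => [fB|fB]; last first.
  by apply/con_edge/setU1P; right; rewrite in_setC.
have := fB; rewrite -E1 in_delta !mem_cls => f1.
have := fB; rewrite -E2 in_delta !mem_cls => f2.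
have mono : subrel (con S) (con (e |: S)) by apply/con_mono/subsetUr.
have ee : con (e |: S) (ends e).1 (ends e).2 by apply/con_edge/setU11.
have excl y : con S (ends e).1 y -> con S (ends e).2 y -> false.
  by move=> h1 h2; move: ne; rewrite /con_ends (con_same h1) con_sym h2.
have main a b : con S (ends e).1 a -> con S (ends e).2 b -> con (e |: S) a b.
  move=> /mono h1 /mono h2; apply: con_trans h2; apply: con_trans ee.
  by rewrite con_sym.
move: f1 f2; rewrite /con_ends.
case h1: (con S (ends e).1 (ends f).1); case h2: (con S (ends e).1 (ends f).2) => //= _.
  case h3: (con S (ends e).2 (ends f).1); first by case: (excl _ h1 h3).
  by case h4: (con S (ends e).2 (ends f).2) => //= _; apply: main.
case h4: (con S (ends e).2 (ends f).2); first by case: (excl _ h2 h4).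
by case h3: (con S (ends e).2 (ends f).1) => //= _; rewrite con_sym; apply: main.
Qed.

Lemma induced_edgesE X e : (e \in induced_edges X) =
  ((ends e).1 \in X) && ((ends e).2 \in X).
Proof. by rewrite inE. Qed.

Lemma induces_connectedP X :
  reflect {in X &, forall x y, con (induced_edges X) x y} (induces_connected X).
Proof.
apply: (iffP forall_inP) => [h x y xX yX|h x xX]; last by apply/forall_inP => y; apply: h.
exact: (forall_inP (h x xX)).
Qed.

Lemma linkedP X Y : reflect
  (exists e x y, [/\ x \in X, y \in Y & joins e x y]) (linked X Y).
Proof.
apply: (iffP exists_inP) => [[x xX /exists_inP[y yY /exists_inP[e _ j]]]|[e [x [y [xX yY j]]]]].
  by exists e, x, y.
by exists x => //; apply/exists_inP; exists y => //; apply/exists_inP; exists e; rewrite ?inE.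
Qed.

(** An edge of [S] with one end in the class has both ends there, so paths of [S] from [x] use
    induced edges only. *)
Lemma cls_connected S x : induces_connected (cls S x).
Proof.
set X := cls S x.
have h y : con S x y -> con (induced_edges X) x y.
  move=> xy; have := con_cut (X := [set y | con (induced_edges X) x y] ) _ xy.
  rewrite !inE con_refl => <- //.
  apply/disjointP => e eS; rewrite in_delta !inE negbK.
  have := con_cut (cls_cut S x) (con_edge eS); rewrite -/X => E.
  case: (boolP ((ends e).1 \in X)) => e1.
    have eX : e \in induced_edges X by rewrite induced_edgesE -E e1.
    by rewrite !(con_sym _ x) (con_same (con_edge eX)).
  have out z : z \notin X -> con (induced_edges X) x z = false.
    move=> zX; apply: contraNF zX => xz; rewrite -(con_cut (X := X) _ xz) ?cls_refl //.
    apply/disjointP => f.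
    by rewrite induced_edgesE in_delta => /andP[-> ->].
  by rewrite !out // -E.
apply/induces_connectedP => y z; rewrite !mem_cls => /h xy /h xz.
by apply: con_trans xz; rewrite con_sym.
Qed.

(** Let [delta Z] be nonempty inside [delta X]. No edge within [X] or within [Y] crosses [Z], so
    each of them lies on one side of [Z]; one crossing edge shows that the sides differ, and then
    all of [delta X] crosses. *)
Lemma delta_bond X Y x : induces_connected X -> induces_connected Y ->
  [disjoint X & Y] -> linked X Y -> X :|: Y = cls [set: edge G] x ->
  bond (delta X).
Proof.
move=> cX cY dXY lXY XYE.
have clo e : ((ends e).1 \in X :|: Y) = ((ends e).2 \in X :|: Y).
  by rewrite XYE; apply: (con_cut (cls_cut _ _)); apply: con_edge; rewrite inE.
have dl e : e \in delta X ->
   ((ends e).1 \in X) && ((ends e).2 \in Y) || ((ends e).1 \in Y) && ((ends e).2 \in X).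
  rewrite in_delta; have := clo e; rewrite !in_setU.
  by case: (_ \in X); case: (_ \in X); case: (_ \in Y); case: (_ \in Y).
have /linkedP[l [a [b [aX bY j]]]] := lXY.
have lX : l \in delta X.
  have bX : b \in X = false by rewrite (disjointFl dXY).
  by move: j; rewrite in_delta /joins => /orP[] /eqP -> /=; rewrite aX bX.
apply/bond_deltaP; split; [by apply/set0Pn; exists l | by exists X|].
move=> Z sZX Z0.
have side W : induces_connected W -> [disjoint induced_edges W & delta X] ->
    forall p q, p \in W -> q \in W -> (p \in Z) = (q \in Z).
  move=> /induces_connectedP h d p q pW qW; apply: con_cut (h _ _ pW qW).
  exact: disjointWr sZX d.
have sX := side X cX; have sY := side Y cY.
have dX : [disjoint induced_edges X & delta X].
  apply/disjointP => f.
  by rewrite induced_edgesE in_delta => /andP[-> ->].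
have dY : [disjoint induced_edges Y & delta X].
  apply/disjointP => f.
  by rewrite induced_edgesE in_delta => /andP[h1 h2]; rewrite !(disjointFl dXY).
have /set0Pn[f fZ] := Z0; have fX := subsetP sZX f fZ.
apply/eqP; rewrite eqEsubset sZX /=; apply/subsetP => g /dl; move: (dl f fX) fZ.
by rewrite !in_delta => /orP[] /andP[f1 f2] + /orP[] /andP[g1 g2];
  rewrite ?(sX dX _ _ f1 g1) ?(sX dX _ _ f2 g2) ?(sX dX _ _ f1 g2) ?(sX dX _ _ f2 g1)
  ?(sY dY _ _ f1 g1) ?(sY dY _ _ f2 g2) ?(sY dY _ _ f1 g2) ?(sY dY _ _ f2 g1) // eq_sym.
Qed.

(** A bond that misses [F] separates the ends of each of its edges in [F], so each of them leaves
    its part of the partition. *)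
Lemma bond_sub_Ext F B : bond B ->
  (B \subset Ext (components F)) = [disjoint B & F].
Proof.
move=> bB; have ER : {in [set: vertex G] & &, equivalence_rel (connect (adj F))}.
  move=> x y z _ _ _; split; first exact: connect0.
  by move=> xy; apply: con_same.
have part := equivalence_partitionP ER.
have extE e : (e \in Ext (components F)) = ~~ con_ends F e.
  rewrite inE; congr negb; have [cov tr _] := and3P part.
  by rewrite eq_pblock ?(eqP cov) ?inE // (pblock_equivalence_partition ER) ?inE.
apply/subsetP/idP => [h|dis e eB]; last by rewrite extE (bond_con_ends bB).
apply/disjointP => e /h; rewrite extE.
by apply: contra; apply: con_edge.
Qed.

End Bonds.

(** * Tripartitions *)

Section Tripartitions.

Variable G : graph.
Implicit Types (e f : edge G) (a b c d u v x y : vertex G).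
Implicit Types (S R F B D : {set edge G}) (X Y Z C : {set vertex G}).
Implicit Types (P : {set {set vertex G}}) (L : {set {set edge G}}).

Lemma linked_sym X Y : linked X Y = linked Y X.
Proof.
have h U V : linked U V -> linked V U.
  case/linkedP=> e [x [y [xU yV j]]]; apply/linkedP; exists e, y, x.
  by rewrite joins_sym.
by apply/idP/idP; apply: h.
Qed.

Lemma linkedUr X Y Z : linked X Y -> linked X (Y :|: Z).
Proof.
case/linkedP=> e [x [y [xX yY j]]]; apply/linkedP; exists e, x, y.
by rewrite in_setU yY.
Qed.

Lemma joins_delta X e a b : joins e a b -> (e \in delta X) = ((a \in X) != (b \in X)).
Proof.
rewrite in_delta /joins; case: (ends e) => u v /= /orP[] /eqP[-> ->] //.
by rewrite eq_sym.
Qed.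

Lemma induces_connectedU X Y : induces_connected X -> induces_connected Y ->
  linked X Y -> induces_connected (X :|: Y).
Proof.
move=> /induces_connectedP cX /induces_connectedP cY /linkedP[e [a [b [aX bY j]]]].
have mono (U V : {set vertex G}) : U \subset V ->
    subrel (con (induced_edges U)) (con (induced_edges V)).
  move=> /subsetP s; apply: con_mono; apply/subsetP => f.
  by rewrite !induced_edgesE => /andP[/s -> /s ->].
set E := induced_edges (X :|: Y).
have ab : con E a b.
  apply: (joins_con _ j); move: (j); rewrite induced_edgesE /joins !in_setU.
  by case/orP=> /eqP -> /=; rewrite aX bY ?orbT.
have a_con x : x \in X :|: Y -> con E a x.
  case/setUP=> [xX|xY]; first exact: (mono X _ (subsetUl _ _) _ _ (cX _ _ aX xX)).
  exact: con_trans ab (mono Y _ (subsetUr _ _) _ _ (cY _ _ bY xY)).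
apply/induces_connectedP => x y /a_con ax /a_con ay.
by apply: con_trans ay; rewrite con_sym.
Qed.

(** An ordered form of [tripartition], convenient for rotating the roles of the parts; [v] only
    names the component. The links force the parts to be nonempty. *)
Record tri X Y Z v : Prop := Tri {
  tri_con : [/\ induces_connected X, induces_connected Y & induces_connected Z];
  tri_dis : [/\ [disjoint X & Y], [disjoint X & Z] & [disjoint Y & Z]];
  tri_lnk : [/\ linked X Y, linked X Z & linked Y Z];
  tri_cov : X :|: Y :|: Z = cls [set: edge G] v }.

Lemma tri_rot X Y Z v : tri X Y Z v -> tri Y Z X v.
Proof.
case=> [[? ? ?] [? ? ?] [? ? ?] E]; split; first by split.
- by split=> //; rewrite disjoint_sym.
- by split=> //; rewrite linked_sym.
by rewrite -E setUC setUA.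
Qed.

(** The other two parts are linked, so they merge into a connected opposite side. *)
Lemma tri_bond X Y Z v : tri X Y Z v -> bond (delta X).
Proof.
case=> [[cX cY cZ] [dXY dXZ dYZ] [lXY lXZ lYZ] E].
apply: (@delta_bond _ X (Y :|: Z) v) => //; last by rewrite setUA.
- exact: induces_connectedU.
- by rewrite disjoint_sym disjoints_subset subUset -!disjoints_subset !(disjoint_sym _ X) dXY.
exact: linkedUr.
Qed.

Lemma tri_neq X Y Z v : tri X Y Z v -> X != set0 /\ X != Y.
Proof.
case=> _ [dXY _ _] [/linkedP[_ [x [_ [xX _ _]]]] _ _] _.
split; first by apply/set0Pn; exists x.
by apply: contraTneq (xX) => E; rewrite (disjointFl dXY) // -E.
Qed.

Lemma tri_tripartition X Y Z v : tri X Y Z v -> tripartition [set X; Y; Z].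
Proof.
move=> t; have t1 := tri_rot t; have t2 := tri_rot t1.
have [X0 XY] := tri_neq t; have [Y0 YZ] := tri_neq t1; have [Z0 ZX] := tri_neq t2.
case: t => [[cX cY cZ] [dXY dXZ dYZ] [lXY lXZ lYZ] E].
apply/and4P; split.
- apply/exists_inP; exists (cls [set: edge G] v); first exact: cls_component.
  apply/and3P; split.
  + by rewrite -E /cover !bigcup_setU !big_set1.
  + apply/trivIsetP => U V; rewrite !inE -!orbA => /or3P[] /eqP -> /or3P[] /eqP ->;
      by rewrite ?eqxx // disjoint_sym.
  + by rewrite !inE !negb_or !(eq_sym set0) X0 Y0 Z0.
- by rewrite setUC cardsU1 !inE negb_or ZX (eq_sym Z) YZ cards2 XY.
- apply/forall_inP => U; rewrite !inE -!orbA => /or3P[] /eqP -> //.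
apply/forall_inP => U; rewrite !inE -!orbA => /or3P[] /eqP ->;
apply/forall_inP => V; rewrite !inE -!orbA => /or3P[] /eqP ->;
  rewrite ?eqxx ?lXY ?lXZ ?lYZ ?implybT //=;
  by rewrite linked_sym ?lXY ?lXZ ?lYZ implybT.
Qed.

Lemma tripartition_tri P : tripartition P ->
  exists X Y Z v, P = [set X; Y; Z] /\ tri X Y Z v.
Proof.
case/and4P=> /exists_inP[C /componentsP[v ->] /and3P[/eqP cov /trivIsetP tr n0]].
move=> /eqP c3 /forall_inP con /forall_inP lnk.
have /card_gt0P[X XP] : 0 < #|P| by rewrite c3.
have /cards2P[Y [Z [YZ E]]] : #|P :\ X| == 2.
  by move: c3; rewrite (cardsD1 X) XP add1n => -[->].
have PE : P = [set X; Y; Z] by rewrite -setUA -E setD1K.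
have [YP XY] : Y \in P /\ X != Y.
  by have : Y \in P :\ X by [rewrite E set21]; rewrite in_setD1 eq_sym => /andP[].
have [ZP XZ] : Z \in P /\ X != Z.
  by have : Z \in P :\ X by [rewrite E set22]; rewrite in_setD1 eq_sym => /andP[].
exists X, Y, Z, v; split=> //; split; first by split; apply: con.
- by split; apply: tr.
- by split; apply: (implyP (forall_inP (lnk _ _) _ _)).
by rewrite -cov PE /cover !bigcup_setU !big_set1.
Qed.

End Tripartitions.

(** * Un-cobalanced edge sets *)

Section ModularCut.

Variables (G : graph) (L : {set {set edge G}}).
Implicit Types (e f : edge G) (a b c d u v x y : vertex G).
Implicit Types (A S R F B D : {set edge G}) (X Y Z C : {set vertex G}).

(** A boolean test by disjointness; [cobalancedPn] relates it to the partition of [F]. *)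
Definition uncobalanced F : bool :=
  [exists B, [&& bond B, B \notin L & [disjoint B & F]]].

Lemma uncobalancedP F :
  reflect (exists B, [/\ bond B, B \notin L & [disjoint B & F]]) (uncobalanced F).
Proof.
by apply: (iffP existsP) => [[B /and3P[? ? ?]]|[B [? ? ?]]]; exists B => //; apply/and3P.
Qed.

Lemma cobalancedPn F : ~ cobalanced L (components F) <-> uncobalanced F.
Proof.
split=> [nc|/uncobalancedP[B [bB BL dis]] c]; last first.
  by move: BL; rewrite c // bond_sub_Ext.
apply: contraT => /uncobalancedP nu; case: nc => B bB; rewrite bond_sub_Ext // => dis.
by apply: contraT => BL; case: nu; exists B.
Qed.

Lemma uncobalancedS F D : D \subset F -> uncobalanced F -> uncobalanced D.
Proof.
move=> sDF /uncobalancedP[B [bB BL dis]]; apply/uncobalancedP; exists B; split=> //.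
exact: disjointWr dis.
Qed.

(** Only connectivity matters: a bond missed by [F] separates the ends of its edges in [F], so none
    of them belongs to [S]. *)
Lemma uncobalanced_con S F : subrel (con S) (con F) -> uncobalanced F -> uncobalanced S.
Proof.
move=> SF /uncobalancedP[B [bB BL dis]]; apply/uncobalancedP; exists B; split=> //.
rewrite disjoint_sym; apply/disjointP => e /con_edge/SF h.
by apply: contraL h; apply: bond_con_ends dis.
Qed.

(* Y and Z are the two classes of a maximal edge set inside X that contains the
   edges of A in X and does not connect a to b. *)
Lemma split_connected X A a b : induces_connected X -> a \in X -> b \in X ->
  [disjoint A & delta X] -> ~~ con A a b -> exists Y Z,
  [/\ a \in Y, b \in Z, [disjoint Y & Z], Y :|: Z = X &
   [/\ induces_connected Y, induces_connected Z, linked Y Z,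
     [disjoint A & delta Y] & [disjoint A & delta Z]]].
Proof.
move=> /induces_connectedP cX aX bX dA nab.
pose P := [pred F : {set edge G} |
  [&& A :&: induced_edges X \subset F, F \subset induced_edges X & ~~ con F a b]].
have h0 : P (A :&: induced_edges X).
  rewrite /= subxx subsetIr; apply: contra nab; exact/con_mono/subsetIl.
have [F /maxsetP[/and3P[AF FX nF] max] _] := maxset_exists h0.
have dX : [disjoint F & delta X].
  apply/disjointP => e /(subsetP FX); rewrite induced_edgesE in_delta.
  by case/andP=> -> ->.
have clsX u : u \in X -> cls F u \subset X.
  by move=> uX; apply/subsetP => w; rewrite mem_cls => /(con_cut dX) <-.
have dis : [disjoint cls F a & cls F b].
  apply/disjointP => w; rewrite !mem_cls => aw; apply: contra nF => bw.
  by apply: con_trans aw _; rewrite con_sym.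
have U : cls F a :|: cls F b = X.
  apply/eqP; rewrite eqEsubset subUset !clsX //=; apply/subsetP => w wX.
  rewrite -(con_cut _ (cX a w aX wX)) ?in_setU ?cls_refl //.
  apply/disjointP => e eX; rewrite in_delta !in_setU negbK.
  case: (boolP (e \in F)) => [/con_edge eF|eF].
    by rewrite !(con_cut (cls_cut _ _) eF).
  (* By maximality, an edge inside [X] but outside [F] connects [a] to [b] once added, so it has one
     end in each of the two classes. *)
  have /negPn cab : ~~ ~~ con (e |: F) a b.
    apply: contra eF => n; rewrite -(max (e |: F)) ?setU11 ?subsetUr //=.
    by rewrite n subUset sub1set eX FX (subset_trans AF (subsetUr _ _)).
  have ends_of u z : con (e |: F) u z -> ~~ con F u z ->
      con F u (ends e).1 || con F u (ends e).2.
    move=> uz; apply: contraR; rewrite negb_or => /andP[n1 n2].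
    by move: uz; rewrite -mem_cls cls_setU1_out ?mem_cls // con_sym.
  have excl u : con F a u -> con F b u = false.
    move=> au; apply: contraNF nF => bu.
    by apply: con_trans au _; rewrite con_sym.
  have := ends_of _ _ cab nF; rewrite con_sym in cab; rewrite con_sym in nF.
  have := ends_of _ _ cab nF; rewrite !mem_cls.
  case: (boolP (con F a _)) => [/excl ->|_] /=.
    by rewrite /= => ->; rewrite orbT.
  by move=> + a2; rewrite (excl _ a2) a2 orbF => ->.
have dA' u : u \in X -> [disjoint A & delta (cls F u)].
  move=> uX; apply/disjointP => e eA.
  case: (boolP (e \in induced_edges X)) => eX.
    by apply: (disjointP _ _ (cls_cut F u)); apply: (subsetP AF); rewrite in_setI eA.
  (* Since [A] avoids [delta X], an edge of [A] that is not inside [X] has both ends outside it. *)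
  have := disjointP _ _ dA e eA; move: eX.
  rewrite induced_edgesE !in_delta negbK => nX /eqP E; move: nX; rewrite E andbb => nX.
  have out w : w \notin X -> w \in cls F u = false.
    by move=> wX; apply: contraNF wX; apply/subsetP/clsX.
  by rewrite !out ?E.
exists (cls F a), (cls F b); split; rewrite ?cls_refl //; split; rewrite ?cls_connected ?dA' //.
have [e eX] : exists2 e, e \in induced_edges X & e \in delta (cls F a).
  apply/exists_inP; rewrite -[X in is_true X]negbK; apply/negP => /exists_inPn h.
  have : b \in cls F a.
    by rewrite -(con_cut _ (cX a b aX bX)) ?cls_refl //; apply/disjointP.
  by rewrite mem_cls (negPf nF).
move: eX; rewrite induced_edgesE -U in_delta !in_setU => /andP[].
case e1: ((ends e).1 \in cls F a); case e2: ((ends e).2 \in cls F a) => //= h1 h2 _.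
  by apply/linkedP; exists e, (ends e).1, (ends e).2; rewrite /joins -surjective_pairing eqxx.
by apply/linkedP; exists e, (ends e).2, (ends e).1; rewrite /joins -surjective_pairing eqxx orbT.
Qed.

Hypothesis linL : linear_class L.

Lemma tri_linear X Y Z v : tri X Y Z v ->
  delta X \in L -> delta Y \in L -> delta Z \in L.
Proof.
move=> t LX LY; apply: contraT => LZ; case: linL => _ /(_ _ (tri_tripartition t)) [].
suff -> : [set U in [set X; Y; Z] | delta U \in L] = [set X; Y].
  by rewrite cards2; have [_ ->] := tri_neq t.
apply/setP => U; rewrite !inE -orbA.
case: (U =P X) => [->|_] /=; first by rewrite LX.
case: (U =P Y) => [->|_] /=; first by rewrite LY.
by case: (U =P Z) => [->|_] //=; rewrite (negPf LZ).
Qed.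

(** Split [X] along [A] into [X1] containing [a] and [X2] containing [b]. The edges [x] and [y] link
    these parts to [Z], giving a tripartition. The bond [delta X1] misses [y |: A] and [delta X2]
    misses [x |: A]; if both sets were cobalanced, linearity would put [delta Z], that is [D], in
    [L]. *)
Lemma uncobalanced_split A D X Z v (x y : edge G) a b c d :
    bond D -> D \notin L -> [disjoint A & D] -> D = delta X ->
    induces_connected X -> induces_connected Z -> [disjoint X & Z] ->
    delta X = delta Z -> X :|: Z = cls [set: edge G] v ->
    joins x a c -> joins y b d -> a \in X -> b \in X -> c \in Z -> d \in Z ->
  ~~ con A a b -> uncobalanced (x |: A) || uncobalanced (y |: A).
Proof.
move=> bD DL dis DX cX cZ dXZ dXZe E jx jy aX bX cZ' dZ nab.
rewrite DX in dis.
have [X1 [X2 [aX1 bX2 d12 X12 [c1 c2 l12 dA1 dA2]]]] := split_connected cX aX bX dis nab.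
have t : tri X1 X2 Z v.
  have := dXZ; rewrite -X12 disjoints_subset subUset -!disjoints_subset => /andP[d1 d2].
  split; [by split|by split| |by rewrite X12].
  by split=> //; apply/linkedP; [exists x, a, c | exists y, b, d].
have t' := tri_rot t.
have nZ w (W : {set vertex G}) : w \in Z -> W \subset X -> w \in W = false.
  by move=> wZ WX; apply: contraTF wZ => /(subsetP WX) wX; rewrite (disjointFr dXZ).
have [s1 s2] : X1 \subset X /\ X2 \subset X by rewrite -X12 subsetUl subsetUr.
apply: contraT => /norP[nx ny].
have L1 : delta X1 \in L.
  apply: contraR ny => n1; apply/uncobalancedP; exists (delta X1); split=> //.
    exact: tri_bond t.
  rewrite disjoint_sym disjoint_setU1 dA1 andbT (joins_delta _ jy).
  by rewrite (nZ d) // (disjointFl d12).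
have L2 : delta X2 \in L.
  apply: contraR nx => n1; apply/uncobalancedP; exists (delta X2); split=> //.
    exact: tri_bond t'.
  rewrite disjoint_sym disjoint_setU1 dA2 andbT (joins_delta _ jx).
  by rewrite (nZ c) // (disjointFr d12).
by move: DL; rewrite DX dXZe (tri_linear t).
Qed.

(** A bond outside [L] missing [A] still serves for one of the larger sets unless it contains both
    [x] and [y]; in that case one of its sides gets split. *)
Lemma uncobalanced_modular A (x y : edge G) : ~~ con_ends (x |: A) y -> uncobalanced A ->
  uncobalanced (x |: A) || uncobalanced (y |: A).
Proof.
move=> ny /uncobalancedP[D [bD DL dis]].
have avoid e : e \notin D -> uncobalanced (e |: A).
  move=> eD; apply/uncobalancedP; exists D; split=> //.
  by rewrite disjoint_sym disjoint_setU1 eD disjoint_sym.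
case: (boolP (x \in D)) => [xD|/avoid -> //].
case: (boolP (y \in D)) => [yD|/avoid ->]; last by rewrite orbT.
have [D1 D2 U] := bond_sides bD xD.
set S := ~: D in D1 D2 U; set X := cls S _ in D1 U; set Z := cls S _ in D2 U.
have dA : [disjoint A & D] by rewrite disjoint_sym.
have dXZ : [disjoint X & Z].
  have nx : ~~ con S (ends x).1 (ends x).2.
    exact: (bond_con_ends bD (disjoint_setC _)).
  apply/disjointP => w; rewrite !mem_cls => h1; apply: contra nx => h2.
  by apply: con_trans h1 _; rewrite con_sym.
have aX : (ends x).1 \in X by apply: cls_refl.
have cZ : (ends x).2 \in Z by apply: cls_refl.
have jx : joins x (ends x).1 (ends x).2 by rewrite /joins -surjective_pairing eqxx.
have jx' : joins x (ends x).2 (ends x).1 by rewrite joins_sym.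
have main b d : joins y b d -> b \in X -> d \in Z ->
    uncobalanced (x |: A) || uncobalanced (y |: A).
  (* If [A] connected the ends of [x] and [y] on both sides of [D], then [x |: A] would connect the
     ends of [y]. So [A] fails on at least one side, and that side is split. *)
  move=> jy bX dZ; case: (boolP (con A (ends x).1 b)) => [h1|]; last first.
    by apply: (@uncobalanced_split A D X Z (ends x).1 x y (ends x).1 b (ends x).2 d);
      rewrite ?cls_connected // -D1 -D2.
  case: (boolP (con A (ends x).2 d)) => [h2|]; last first.
    apply: (@uncobalanced_split A D Z X (ends x).1 x y (ends x).2 d (ends x).1 b);
      rewrite ?cls_connected // -?D1 -?D2 //; [by rewrite disjoint_sym|by rewrite setUC|].
    by rewrite joins_sym.
  case/negP: ny; rewrite -(joins_con_ends _ jy).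
  have mono : subrel (con A) (con (x |: A)) by apply/con_mono/subsetUr.
  apply: con_trans (mono _ _ h2); apply: (con_trans (y := (ends x).1)).
    by rewrite con_sym mono.
  exact/con_edge/setU11.
have jy : joins y (ends y).1 (ends y).2 by rewrite /joins -surjective_pairing eqxx.
have jy' : joins y (ends y).2 (ends y).1 by rewrite joins_sym.
have := yD; rewrite {1}D1 in_delta; have := yD; rewrite {1}D2 in_delta.
case y1: ((ends y).1 \in X); case y2: ((ends y).2 \in X) => //=.
  case y3: ((ends y).1 \in Z); first by rewrite (disjointFr dXZ y1) in y3.
  by case y4: ((ends y).2 \in Z) => // _ _; apply: main jy _ _.
case y4: ((ends y).2 \in Z); first by rewrite (disjointFr dXZ y2) in y4.
by case y3: ((ends y).1 \in Z) => // _ _; apply: main jy' _ _.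
Qed.

End ModularCut.

(** * Modular pairs *)

Section ModularPairs.

Variable G : graph.
Implicit Types (e f : edge G) (a b c d u v x y : vertex G).
Implicit Types (S R F B D : {set edge G}) (X Y Z : {set vertex G}).

Local Notation c := (ncomp [set: edge G]).

Lemma modular_pairP B1 B2 :
  reflect [/\ bond B1, bond B2 & ncomp (~: (B1 :|: B2)) = c + 2] (modular_pair B1 B2).
Proof.
by apply: (iffP and3P) => [[b1 b2 /eqP h]|[b1 b2 h]]; split=> //; apply/eqP.
Qed.

(** The parts exhaust a component, so an edge leaving [Z] enters [X] or [Y]; this absorbs the third
    cut. *)
Lemma tri_modular X Y Z v : tri X Y Z v ->
  modular_pair (delta X) (delta Y) /\
  delta X :|: delta Y :|: delta Z = delta X :|: delta Y.
Proof.
move=> t; case: (t) => [[/induces_connectedP cX /induces_connectedP cY /induces_connectedP cZ]].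
move=> [dXY dXZ dYZ] [lXY lXZ lYZ] U.
have mem w : w \in X :|: Y :|: Z ->
    [|| [&& w \in X, w \notin Y & w \notin Z],
        [&& w \notin X, w \in Y & w \notin Z] |
        [&& w \notin X, w \notin Y & w \in Z]].
  rewrite !in_setU => /orP[/orP[]|] h; rewrite h /=.
  - by rewrite (disjointFr dXY h) (disjointFr dXZ h).
  - by rewrite (disjointFl dXY h) (disjointFr dYZ h) orbT.
  by rewrite (disjointFl dXZ h) (disjointFl dYZ h) !orbT.
have clo e : ((ends e).1 \in X :|: Y :|: Z) = ((ends e).2 \in X :|: Y :|: Z).
  by rewrite U; apply: (con_cut (cls_cut _ _)); apply: con_edge; rewrite inE.
have E3 : delta X :|: delta Y :|: delta Z = delta X :|: delta Y.
  apply/setUidPl/subsetP => e; rewrite in_setU !in_delta.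
  case: (boolP ((ends e).1 \in X :|: Y :|: Z)) => h1; have h2 := h1; rewrite clo in h2.
    by move: (mem _ h1) (mem _ h2); do 6!case: (_ \in _).
  move: h1 h2; rewrite !in_setU => /norP[/norP[/negPf -> /negPf ->] /negPf ->].
  by move=> /norP[/norP[/negPf -> /negPf ->] /negPf ->].
have bX := tri_bond t; have bY := tri_bond (tri_rot t).
split=> //; apply/modular_pairP; split=> //.
set D := delta X :|: delta Y.
have /linkedP[e [a [b [aX bY' je]]]] := lXY.
have /linkedP[f [a' [z [aX' zZ jf]]]] := lXZ.
apply/eqP; rewrite eqn_leq; apply/andP; split; last first.
  have ne : delta X != delta Y.
    have fX : f \in delta X by rewrite (joins_delta X jf) aX' (disjointFl dXZ zZ).
    apply: contraTneq fX => ->; rewrite (joins_delta Y jf) (disjointFr dXY aX').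
    by rewrite (disjointFl dYZ zZ).
  by apply: two_bonds_ncomp bX bY ne _ _; rewrite disjoints_subset setCK;
    [apply: subsetUl | apply: subsetUr].
(* Restoring one link between [X] and [Y] and one between [X] and [Z] reconnects the component, so
   at most two components were gained. *)
set S := f |: (e |: ~: D).
have sDS : ~: D \subset S by rewrite /S setUA subsetUr.
suff le : ncomp S <= c.
  rewrite (ncompU1 _ e) (ncompU1 _ f) -/S -addnA leq_add //.
  by rewrite -[2]/(1 + 1) leq_add // leq_b1.
apply/leq_ncomp/sub_con => g _.
have intra W : W \in [set X; Y; Z] ->
    {in W &, forall u w, con (induced_edges W) u w} -> {in W &, forall u w, con S u w}.
  move=> WP cW u w uW wW; apply: con_mono (cW u w uW wW).
  apply: subset_trans sDS; apply/subsetP => h; rewrite induced_edgesE in_setC /D in_setU !in_delta.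
  case/andP=> h1 h2; move: WP h1 h2; rewrite !inE -orbA => /or3P[] /eqP -> h1 h2.
  - by rewrite h1 h2 (disjointFr dXY h1) (disjointFr dXY h2).
  - by rewrite h1 h2 (disjointFl dXY h1) (disjointFl dXY h2).
  by rewrite (disjointFl dXZ h1) (disjointFl dXZ h2) (disjointFl dYZ h1) (disjointFl dYZ h2).
have iX := intra X _ cX; have iY := intra Y _ cY; have iZ := intra Z _ cZ.
have ab : con S a b by apply: joins_con je; rewrite !inE eqxx orbT.
have az : con S a' z by apply: joins_con jf; rewrite !inE eqxx.
have a_con w : w \in X :|: Y :|: Z -> con S a w.
  case/setUP=> [/setUP[]|] wW; first by apply: iX; rewrite // !inE eqxx.
    by apply: con_trans ab _; apply: iY; rewrite // !inE eqxx ?orbT.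
  apply: (con_trans (y := a')); first by apply: iX; rewrite // !inE eqxx.
  by apply: con_trans az _; apply: iZ; rewrite // !inE eqxx ?orbT.
case: (boolP (g \in D)) => gD; last by apply/con_edge/(subsetP sDS); rewrite in_setC.
have g1 : (ends g).1 \in X :|: Y :|: Z.
  apply: contraTT gD => g1; have g2 := g1; rewrite clo in g2.
  move: g1 g2; rewrite /D !in_setU !in_delta.
  by move=> /norP[/norP[/negPf -> /negPf ->] _] /norP[/norP[/negPf -> /negPf ->] _].
apply: (con_trans (y := a)); last by apply: a_con; rewrite -clo.
by rewrite con_sym a_con.
Qed.

(** By [tri_modular] a tribond is itself the union of a modular pair, so the distinction between
    tribonds and dibonds disappears. *)
Lemma tribond_dibondP D :
  reflect (exists B1 B2, modular_pair B1 B2 /\ D = B1 :|: B2) (tribond D || dibond D).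
Proof.
apply: (iffP orP) => [[/existsP[P /andP[/tripartition_tri[X [Y [Z [v [-> t]]]]]]]|]|].
- rewrite !bigcup_setU !big_set1 => /eqP ->; have [m ->] := tri_modular t.
  by exists (delta X), (delta Y).
- by case/andP=> /existsP[B1 /existsP[B2 /andP[m /eqP ->]]] _; exists B1, B2.
case=> B1 [B2 [m ->]]; case: (boolP (tribond _)) => t; [by left|right].
rewrite /dibond t andbT; apply/existsP; exists B1; apply/existsP; exists B2.
by rewrite m eqxx.
Qed.

(** An edge of the union lies in a bond missed by the complement, so restoring one that [D] lacks
    lowers the count, which was exactly [c + 2]. *)
Lemma modular_pair_minimal B1 B2 D : modular_pair B1 B2 -> D \proper B1 :|: B2 ->
  ncomp (~: D) < c + 2.
Proof.
case/modular_pairP=> b1 b2 E /properP[sD [e eB eD]].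
have ne : ~~ con_ends (~: (B1 :|: B2)) e.
  have dis B : B \subset B1 :|: B2 -> [disjoint B & ~: (B1 :|: B2)].
    by rewrite disjoints_subset setCK.
  case/setUP: eB; [apply: (bond_con_ends b1)|apply: (bond_con_ends b2)];
    by apply: dis; rewrite ?subsetUl ?subsetUr.
rewrite -E (ncompU1 (~: (B1 :|: B2)) e) ne addn1 ltnS; apply: ncompS.
by rewrite subUset sub1set in_setC eD setCS.
Qed.

(** Choose a bond [B1] in [D], an edge [e'] of it, and a bond [B2] in [D] avoiding [e']. Being
    distinct, they already cost two components, so by minimality they fill [D]. *)
Lemma minimal_modular_pair D : c + 2 <= ncomp (~: D) ->
  (forall D', D' \proper D -> ncomp (~: D') < c + 2) ->
  exists B1 B2, modular_pair B1 B2 /\ D = B1 :|: B2.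
Proof.
move=> cD min.
(* Restoring [e] lowers the count by at most one, so a bond survives inside [D] without [e]. *)
have sep e : e \in D -> exists B, [/\ bond B, B \subset D & e \notin B].
  move=> eD; have lt : c < ncomp (e |: ~: D).
    have := leq_trans cD (_ : _ <= ncomp (e |: ~: D) + 1); rewrite addn2 addn1 ltnS; apply.
    by rewrite (ncompU1 _ e) -addn1 leq_add2l leq_b1.
  have [B bB] := exists_bond_ncomp lt.
  rewrite disjoint_sym disjoint_setU1 => /andP[eB dB]; exists B; split=> //.
  by rewrite -[D]setCK -disjoints_subset disjoint_sym.
have D0 : D != set0.
  by apply: contraTneq cD => ->; rewrite setC0 -ltnNge addn2 ltnW.
have /set0Pn[e eD] := D0; have [B1 [b1 s1 _]] := sep e eD.
have /bond_deltaP[/set0Pn[e' e1] _ _] := b1.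
have [B2 [b2 s2 n2]] := sep e' (subsetP s1 _ e1).
have ne : B1 != B2 by apply: contraTneq e1 => ->.
have ge : c + 2 <= ncomp (~: (B1 :|: B2)).
  by apply: two_bonds_ncomp b1 b2 ne _ _; rewrite disjoints_subset setCK;
    [apply: subsetUl | apply: subsetUr].
have DE : D = B1 :|: B2.
  apply/eqP; rewrite eq_sym eqEproper subUset s1 s2 /=.
  by apply: contraL ge => /min; rewrite -ltnNge.
exists B1, B2; split=> //; apply/modular_pairP; split=> //.
(* For the upper bound, [D :\ e'] gives at most [c + 1] components by minimality, and [e'] accounts
   for at most one more. *)
apply/eqP; rewrite eqn_leq ge andbT -DE (ncompU1 _ e').
rewrite -[2]/(1 + 1) addnA leq_add ?leq_b1 //.
have := min (D :\ e') (properD1 (subsetP s1 _ e1)).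
by rewrite setCD setUC addn2 ltnS -addn1.
Qed.

End ModularPairs.

(** * The single-element extension *)

Section JoinExtension.

Variables (G : graph) (L : {set {set edge G}}).
Hypothesis linL : linear_class L.
Implicit Types (e f : edge G) (B F : {set edge G}) (A D : {set option (edge G)}).

Local Notation c := (ncomp [set: edge G]).
Local Notation uncob := (uncobalanced L).

Definition edges_of A : {set edge G} := Some @^-1: A.

Lemma in_edges_of A e : (e \in edges_of A) = (Some e \in A).
Proof. by rewrite inE. Qed.

Lemma mem_imset_Some B e : (Some e \in Some @: B) = (e \in B).
Proof. by rewrite mem_imset // => ? ? []. Qed.

Lemma None_imset_Some B : (None \in Some @: B) = false.
Proof. by apply/imsetP => -[]. Qed.

Lemma edges_of_Some B : edges_of (Some @: B) = B.
Proof. by apply/setP => e; rewrite in_edges_of mem_imset_Some. Qed.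

Lemma edges_of_NoneU A : edges_of (None |: A) = edges_of A.
Proof. by apply/setP => e; rewrite !in_edges_of in_setU1. Qed.

Lemma edges_of_SomeU e A : edges_of (Some e |: A) = e |: edges_of A.
Proof. by apply/setP => f; rewrite !(in_edges_of, in_setU1). Qed.

Lemma edges_ofC A : edges_of (~: A) = ~: edges_of A.
Proof. by apply/setP => e; rewrite !(in_edges_of, in_setC). Qed.

Lemma edges_ofS A A' : A \subset A' -> edges_of A \subset edges_of A'.
Proof. exact: preimsetS. Qed.

Lemma edges_ofE A :
  A = if None \in A then None |: Some @: edges_of A else Some @: edges_of A.
Proof.
apply/setP => -[e|]; last by case: ifP => _; rewrite ?setU11 ?None_imset_Some.
by case: ifP => _; rewrite ?in_setU1 /= mem_imset_Some in_edges_of.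
Qed.

Lemma card_edges_of A : #|A| = (None \in A) + #|edges_of A|.
Proof.
rewrite {1}[A]edges_ofE; have inj : injective (@Some (edge G)) by move=> ? ? [].
by case: ifP => _; rewrite ?cardsU1 ?None_imset_Some card_imset.
Qed.

(** For a linear class, this is the single-element extension of the cycle matroid by [None] whose
    modular cut is the family of cobalanced flats. *)
Definition ext_indep : {set {set option (edge G)}} :=
  [set A | acyclic (edges_of A) && ((None \in A) ==> uncob (edges_of A))].

Lemma in_ext_indep A : (A \in ext_indep) =
  acyclic (edges_of A) && ((None \in A) ==> uncob (edges_of A)).
Proof. by rewrite inE. Qed.

Lemma ext_indepS A A' : A \in ext_indep -> A' \subset A -> A' \in ext_indep.
Proof.
rewrite !in_ext_indep => /andP[aA uA] sA; have sE := edges_ofS sA.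
rewrite (acyclicS sE aA); apply/implyP => /(subsetP sA) nA.
exact: uncobalancedS sE (implyP uA nA).
Qed.

Lemma ext_indep_aug A A' : A \in ext_indep -> A' \in ext_indep -> #|A| < #|A'| ->
  exists2 x, x \in A' & (x \notin A) && (x |: A \in ext_indep).
Proof.
rewrite !in_ext_indep !card_edges_of => /andP[aA uA] /andP[aA' uA'] lt.
have extend e : Some e \in A' -> ~~ con_ends (edges_of A) e ->
    ((None \in A) ==> uncob (e |: edges_of A)) ->
    exists2 x, x \in A' & (x \notin A) && (x |: A \in ext_indep).
  move=> eA' ne un; exists (Some e); rewrite // in_ext_indep edges_of_SomeU.
  rewrite acyclicU1_con // in_setU1 /= un andbT -in_edges_of.
  by apply: contra ne; apply: con_edge.
case: (boolP (None \in A)) lt uA extend => [nA|nA] /= lt uA extend; last first.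
  case: (boolP (None \in A')) lt uA' => /= nA' lt uA'; last first.
    have [e eA' ne] := acyclic_aug aA aA' lt.
    by apply: (extend e); rewrite -?in_edges_of.
  (* [None] is tried first. Otherwise [A] is cobalanced and some edge of [A'] is not spanned by [A]:
     as [A'] has at least as many edges, the spans would else agree and [A] would be
     un-cobalanced. *)
  case: (boolP (uncob (edges_of A))) => u.
    exists None; rewrite // nA in_ext_indep edges_of_NoneU aA u.
    by rewrite implybT.
  have /existsP[e /andP[eA' ne]] :
      [exists e, (e \in edges_of A') && ~~ con_ends (edges_of A) e].
    apply: contraNT u => /existsPn h.
    have sub : subrel (con (edges_of A')) (con (edges_of A)).
      by apply: sub_con => e eA'; have := h e; rewrite eA' negbK.
    apply: uncobalanced_con uA'; apply: ncomp_eq_con sub _.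
    rewrite -(leq_add2l #|edges_of A|) (eqP aA) -(eqP aA') leq_add2r.
    by rewrite add0n add1n ltnS in lt.
  by apply: (extend e); rewrite -?in_edges_of.
have lt' : #|edges_of A| < #|edges_of A'|.
  by move: lt; case: (None \in A'); rewrite /= ?add1n ?add0n ?ltnS => // /ltnW.
have [x xA' nx] := acyclic_aug aA aA' lt'.
case: (boolP (uncob (x |: edges_of A))) => ux; first by apply: (extend x); rewrite -?in_edges_of.
case: (boolP [exists y in edges_of A', ~~ con_ends (edges_of A) y && uncob (y |: edges_of A)]).
  by case/exists_inP=> y yA' /andP[ny uy]; apply: (extend y); rewrite -?in_edges_of.
(* When neither [x] nor any other edge of [A'] extends [A], modularity puts every edge of [A'] in
   the span of [x |: edges_of A]. *)
move/exists_inPn => h; have sub : subrel (con (edges_of A')) (con (x |: edges_of A)).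
  apply: sub_con => y yA'; apply: contraT => ny.
  have := uncobalanced_modular linL ny uA; rewrite (negPf ux) /= => uy.
  have := h y yA'; rewrite uy andbT negbK => /(con_mono (subsetUr [set x] _)) xy.
  by move: ny; rewrite /con_ends xy.
have ax := acyclicU1_con aA nx.
have cx : #|x |: edges_of A| = #|edges_of A|.+1.
  have xA : x \notin edges_of A by apply: contra nx; apply: con_edge.
  by rewrite cardsU1 xA.
(* With [None] in [A'], the edge counts force equal spans, so [x |: edges_of A] inherits
   un-cobalance. Without it, [A'] would be a forest with more edges than the forest spanning it. *)
case/negP: ux; case: (boolP (None \in A')) uA' lt => /= nA' uA' lt.
  apply: uncobalanced_con uA'; apply: ncomp_eq_con sub _.
  by rewrite -(leq_add2l #|x |: edges_of A|) (eqP ax) -(eqP aA') leq_add2r cx.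
have := leq_ncomp sub; rewrite leqNgt => /negP; case.
by rewrite -(ltn_add2l #|x |: edges_of A|) (eqP ax) -(eqP aA') ltn_add2r cx.
Qed.

Lemma ext_matroid_subproof : matroid_axiom ext_indep.
Proof.
apply/and3P; split.
- by rewrite in_ext_indep in_set0 andbT /edges_of preimset0 acyclic0.
- apply/forall_inP => A hA; apply/forallP => A'; apply/implyP; exact: ext_indepS.
apply/forall_inP => A hA; apply/forall_inP => A' hA'; apply/implyP => lt.
have [x xA' /andP[xA h]] := ext_indep_aug hA hA' lt.
by apply/exists_inP; exists x; rewrite // in_setD xA.
Qed.

Definition ext_matroid : matroid (option (edge G)) := Matroid ext_matroid_subproof.

(** [None] takes the place of one edge: the bond that witnesses un-cobalance is missed and leaves an
    extra component. *)
Lemma ext_indep_card A : A \in ext_indep -> #|A| + c <= #|vertex G|.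
Proof.
rewrite in_ext_indep card_edges_of => /andP[/eqP <-].
rewrite [_ + #|_|]addnC -addnA leq_add2l; case: (None \in A) => /=.
  by case/uncobalancedP=> B [bB _ dis]; apply: bond_ncomp_gt bB dis.
by move=> _; apply/ncompS/subsetT.
Qed.

(** A smaller independent set can be augmented from a spanning forest, so bases are the independent
    sets attaining the bound. *)
Lemma ext_baseP A :
  reflect (A \in ext_indep /\ #|A| + c = #|vertex G|) (base ext_matroid A).
Proof.
apply: (iffP maxsetP) => [[/= iA max]|[iA cA]]; split=> //.
  have [T [_ aT cT]] := spanning_forest [set: edge G].
  have iT : Some @: T \in ext_indep.
    by rewrite in_ext_indep edges_of_Some aT None_imset_Some.
  apply/eqP; rewrite eqn_leq ext_indep_card //= leqNgt; apply/negP => lt.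
  have [|x _ /andP[xA ix]] := ext_indep_aug iA iT.
    by rewrite (card_edges_of (Some @: T)) None_imset_Some edges_of_Some add0n
      -(ltn_add2r c) -{2}cT (eqP aT).
  by move: xA; rewrite -(max _ ix (subsetUr _ _)) setU11.
move=> A' /= iA' sAA'; apply/esym/eqP; rewrite eqEcard sAA'.
by rewrite -(leq_add2r c) cA ext_indep_card.
Qed.

(* A set is coindependent iff its complement spans.  As e_0 = None can replace one
   missing edge, the complement of a set A avoiding e_0 may have one component too
   many, provided that the bond it misses is not in L. *)
Lemma ext_coindepE A : coindep ext_matroid A =
  if None \in A then ncomp (~: edges_of A) == c
  else (ncomp (~: edges_of A) < c + 2) && [forall B in L, ~~ (B \subset edges_of A)].
Proof.
have [linbond _] := linL.
apply/existsP/idP => [[I /andP[/ext_baseP[iI cI] sAI]]|].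
  have sI : edges_of I \subset ~: edges_of A.
    by rewrite -edges_ofC; apply: edges_ofS; rewrite subsetC.
  move: iI cI; rewrite in_ext_indep card_edges_of => /andP[/eqP aI uI].
  rewrite -aI [_ + #|_|]addnC -addnA => /addnI.
  case: (boolP (None \in I)) uI => /= nI uI E.
    have -> : None \in A = false.
      by apply: contraTF nI => /(subsetP sAI); rewrite in_setC.
    have /uncobalancedP[D [bD DL dis]] := uI.
    rewrite addn2 ltnS -add1n E ncompS //=.
    (* The base [I] has just one component too many. A bond of [L] inside [A] would be a second bond
       missed by [I], besides [D], and would force two. *)
    apply/forall_inP => B BL; apply/negP => sBA.
    have ne : B != D by apply: contraNneq DL => <-.
    have dB : [disjoint B & edges_of I].
      by rewrite disjoints_subset; apply: subset_trans sBA _; rewrite subsetC.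
    have := two_bonds_ncomp (linbond _ BL) bD ne dB dis.
    by rewrite -E addnC leq_add2r.
  have Ec : ncomp (~: edges_of A) = c.
    by apply/eqP; rewrite eqn_leq {1}[c]E ncompS //= ncompS // subsetT.
  rewrite Ec eqxx; case: ifP => // _; rewrite addn2 leqnSn /=.
  apply/forall_inP => B BL; apply/negP => sBA.
  have := bond_ncomp_gt (linbond _ BL) (_ : [disjoint B & ~: edges_of A]).
  by rewrite Ec ltnn disjoints_subset setCK => /(_ sBA).
have [T [sT aT cT]] := spanning_forest (~: edges_of A).
have sub : Some @: T \subset ~: A.
  apply/subsetP => _ /imsetP[e eT ->]; rewrite in_setC -in_edges_of.
  by have := subsetP sT _ eT; rewrite in_setC.
have spanning : ncomp (~: edges_of A) = c ->
    base ext_matroid (Some @: T) && (A \subset ~: Some @: T).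
  move=> E; rewrite subsetC sub andbT; apply/ext_baseP; split.
    by rewrite in_ext_indep edges_of_Some aT None_imset_Some.
  by rewrite card_edges_of edges_of_Some None_imset_Some add0n -E -cT (eqP aT).
case: ifP => [_ /eqP/spanning h|nA /andP[lt /forall_inP noL]]; first by exists (Some @: T).
have [/spanning h|ne] := eqVneq (ncomp (~: edges_of A)) c; first by exists (Some @: T).
have lt1 : c < ncomp (~: edges_of A) by rewrite ltn_neqAle eq_sym ne ncompS ?subsetT.
have E : ncomp T = c + 1.
  by apply/eqP; rewrite cT eqn_leq -ltnS -addnS lt addn1.
have [B bB dB] := exists_bond_ncomp lt1.
exists (None |: Some @: T); rewrite subsetC subUset sub1set in_setC nA sub !andbT.
apply/ext_baseP; split.
  rewrite in_ext_indep edges_of_NoneU edges_of_Some aT; apply/implyP => _.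
  apply/uncobalancedP; exists B; split=> //; last exact: disjointWr sT dB.
  apply/negP => /noL/negP; case; by rewrite -[edges_of A]setCK -disjoints_subset.
rewrite card_edges_of setU11 edges_of_NoneU edges_of_Some -(eqP aT) E /=.
by rewrite [1 + _]addnC -addnA [1 + _]addnC.
Qed.

Lemma ext_codepE A : ~~ coindep ext_matroid A =
  if None \in A then c < ncomp (~: edges_of A)
  else (c + 2 <= ncomp (~: edges_of A)) || [exists B in L, B \subset edges_of A].
Proof.
rewrite ext_coindepE; case: ifP => _.
  by rewrite ltn_neqAle eq_sym ncompS ?subsetT ?andbT.
rewrite negb_and -leqNgt negb_forall_in; congr (_ || _).
by apply: eq_existsb => B; rewrite negbK.
Qed.

Lemma ext_cocircuitP D : reflect
  (~~ coindep ext_matroid D /\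
    forall A, A \subset D -> ~~ coindep ext_matroid A ->
      edges_of D \subset edges_of A /\ (None \in D -> None \in A))
  (cocircuit ext_matroid D).
Proof.
rewrite /cocircuit; apply: (iffP minsetP) => -[dD min]; split=> // A.
  by move=> sAD dA; rewrite (min A dA sAD).
move=> dA sAD; have [sE sN] := min A sAD dA.
apply/eqP; rewrite eqEsubset sAD; apply/subsetP => -[e|//].
by rewrite -!in_edges_of; apply: subsetP.
Qed.

Lemma cocircuits_ext_matroid : cocircuits ext_matroid = J0_cocircuits L.
Proof.
have [linbond _] := linL.
have L_codep B : B \in L -> ~~ coindep ext_matroid (Some @: B).
  move=> BL; rewrite ext_codepE None_imset_Some edges_of_Some; apply/orP; right.
  by apply/exists_inP; exists B.
have NSomeS B D : B \subset edges_of D -> Some @: B \subset D.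
  by move=> /subsetP s; apply/subsetP => _ /imsetP[e /s + ->]; rewrite in_edges_of.
(* Inside a bond at most one component is gained, so a set without [None] can be codependent there
   only through a bond of [L]. *)
have below B A : bond B -> edges_of A \subset B -> (c + 2 <= ncomp (~: edges_of A)) = false.
  move=> bB sAB; apply/negbTE; rewrite -ltnNge addn2 ltnS -addn1 -(bond_ncomp bB).
  by apply: ncompS; rewrite setCS.
have sub_edges A (B : {set edge G}) : A \subset Some @: B -> edges_of A \subset B.
  by move=> /edges_ofS; rewrite edges_of_Some.
have noNone A (B : {set edge G}) : A \subset Some @: B -> None \in A = false.
  by move=> sAB; apply/negP => /(subsetP sAB); rewrite None_imset_Some.
apply/setP => D; rewrite inE /J0_cocircuits !in_setU; apply/idP/idP.
  move=> /ext_cocircuitP[dD min]; move: (dD); rewrite ext_codepE.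
  have DE := edges_ofE D; case: ifP DE => [nD DE|nD DE].
    (* If the bond [B] inside [D] were in [L], it would be codependent without [None], against
       minimality. Hence [None] with [B] is codependent and fills [D]. *)
    case/exists_bond_ncomp=> B bB; rewrite disjoints_subset setCK => sB.
    have [|noL] := boolP (B \in L).
      move=> BL; have [_ /(_ nD)] := min _ (NSomeS _ _ sB) (L_codep _ BL).
      by rewrite None_imset_Some.
    have sND : None |: Some @: B \subset D by rewrite subUset sub1set nD NSomeS.
    have [|sE _] := min _ sND.
      rewrite ext_codepE setU11 edges_of_NoneU edges_of_Some.
      exact: bond_ncomp_gt bB (disjoint_setC B).
    rewrite edges_of_NoneU edges_of_Some in sE.
    have EB : edges_of D = B by apply/eqP; rewrite eqEsubset sE.
    apply/orP; left; apply/orP; right; rewrite DE EB.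
    by apply: imset_f; rewrite inE bB.
  (* Without [None], either [D] contains a bond of [L] and equals it, or [D] is minimal among the
     sets costing two components. *)
  have [/exists_inP[B BL sB] _|/exists_inPn noL] := boolP [exists B in L, B \subset edges_of D].
    have [sE _] := min _ (NSomeS _ _ sB) (L_codep _ BL).
    rewrite edges_of_Some in sE.
    have EB : edges_of D = B by apply/eqP; rewrite eqEsubset sE.
    by rewrite DE EB imset_f.
  rewrite orbF => cD; apply/orP; right; rewrite DE; apply: imset_f.
  rewrite inE; apply/andP; split; last exact/forall_inP.
  apply/tribond_dibondP; apply: minimal_modular_pair cD _ => D' /properP[sD' [e eD eD']].
  rewrite ltnNge; apply: contra eD' => cD'.
  have [|sE _] := min _ (NSomeS _ _ sD').
    by rewrite ext_codepE None_imset_Some edges_of_Some cD'.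
  by move: sE; rewrite edges_of_Some => /subsetP; apply.
case/orP=> [/orP[]|] /imsetP[B].
- move=> BL ->; have bB := linbond _ BL; apply/ext_cocircuitP; split; first exact: L_codep.
  move=> A sA; rewrite ext_codepE None_imset_Some (noNone _ _ sA) edges_of_Some.
  rewrite (below B) ?sub_edges //= => /exists_inP[B' B'L sB']; split=> //.
  by rewrite -(bond_sub_eq (linbond _ B'L) bB (subset_trans sB' (sub_edges _ _ sA))).
- rewrite inE => /andP[bB BL] ->; apply/ext_cocircuitP; split.
    rewrite ext_codepE setU11 edges_of_NoneU edges_of_Some.
    exact: bond_ncomp_gt bB (disjoint_setC B).
  move=> A sA; have sE : edges_of A \subset B.
    by have := edges_ofS sA; rewrite edges_of_NoneU edges_of_Some.
  rewrite ext_codepE edges_of_NoneU edges_of_Some; case: ifP => nA.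
    case/exists_bond_ncomp=> B' bB'; rewrite disjoints_subset setCK => sB'.
    by rewrite -(bond_sub_eq bB' bB (subset_trans sB' sE)).
  rewrite (below B) //= => /exists_inP[B' B'L sB']; case/negP: BL.
  by rewrite -(bond_sub_eq (linbond _ B'L) bB (subset_trans sB' sE)).
rewrite inE => /andP[/tribond_dibondP[B1 [B2 [m BE]]] /forall_inP noL] ->.
apply/ext_cocircuitP; split.
  rewrite ext_codepE None_imset_Some edges_of_Some BE.
  by have /modular_pairP[_ _ ->] := m; rewrite leqnn.
(* No bond of [L] fits inside, so a codependent subset costs two components, which no proper subset
   of the union of a modular pair does. *)
move=> A sA; rewrite ext_codepE None_imset_Some (noNone _ _ sA) edges_of_Some.
have sE := sub_edges _ _ sA; case/orP=> [cA|/exists_inP[B' B'L sB']]; last first.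
  by case/negP: (noL _ B'L); apply: subset_trans sB' sE.
split=> //; apply: contraTT cA => nBA; rewrite -ltnNge.
by apply: modular_pair_minimal m _; rewrite -BE properE sE.
Qed.

(** A matroid with the prescribed cocircuits exists, so the default is never reached, and cocircuits
    determine the matroid. *)
Lemma J0_ext_matroid : J0 L = ext_matroid.
Proof.
rewrite /J0 /matroid_of_cocircuits; case: pickP => [M /eqP E|/(_ ext_matroid)] /=.
  by apply: cocircuits_inj; rewrite E cocircuits_ext_matroid.
by rewrite cocircuits_ext_matroid eqxx.
Qed.

(** A bond outside [L] misses the empty set, so [None] is not a loop and contracting it means adding
    it to [F]. *)
Lemma join_matroid_indep F : ~ trivial_class L ->
  (F \in indep (join_matroid L)) = acyclic F && uncob F.
Proof.
move=> nt; have None_indep : [set None] \in ext_indep.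
  rewrite in_ext_indep -[[set None]]setU0 edges_of_NoneU /edges_of preimset0 acyclic0.
  apply/implyP => _; apply: contraT => /uncobalancedP h; case: nt => B bB.
  apply: contraT => BL; case: h; exists B; split=> //.
  by rewrite -setI_eq0 setI0.
rewrite inE J0_ext_matroid /basis_None None_indep in_ext_indep.
by rewrite edges_of_NoneU edges_of_Some setU11.
Qed.

End JoinExtension.

Theorem theorem3p6 (G : graph) (L : {set {set edge G}})
  (hL : linear_class L) (hnontrivial : ~ trivial_class L) (F : {set edge G}) :
  F \in indep (join_matroid L) <->
  forest F /\ ~ cobalanced L (components F).
Proof.
rewrite join_matroid_indep //.
by split=> [/andP[/forestP fF /cobalancedPn uF]|[/forestP -> /cobalancedPn ->]].
Qed.
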